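(* Let $\{(X_i,\tau_i):i\in\mathcal{I}\}$ be a collection of barreled extended locally convex spaces. Then the product space $\prod_{i\in\mathcal{I}}X_i$ with the product topology $\prod_{i\in\mathcal{I}}\tau_i$ is a barreled extended locally convex space.
   Context: Vector spaces are over $\mathbb{K}\in\{\mathbb{R},\mathbb{C}\}$. An extended seminorm on a vector space $X$ is a map $\rho:X\to[0,\infty]$ with $\rho(\alpha x)=|\alpha|\rho(x)$ (convention $0\cdot\infty=0$) and $\rho(x+y)\le\rho(x)+\rho(y)$. An extended locally convex space (elcs) is a vector space $X$ with a Hausdorff topology $\tau$ induced by a family $\mathcal{P}$ of extended seminorms, i.e. the sets $\{y\in X:\rho(y-x)<\epsilon\}$ ($\rho\in\mathcal{P}$, $x\in X$, $\epsilon>0$) form a subbase of $\tau$. A barrel in an elcs is a closed, absolutely convex (balanced and convex), absorbing subset; an elcs is barreled if every barrel in it is a neighborhood of $0$. *)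

(* Defs.v *)
From HB Require Import structures.
From mathcomp Require Import all_boot all_order all_algebra complex.
From mathcomp Require Import all_classical all_reals all_analysis.

Set Implicit Arguments.
Unset Strict Implicit.
Unset Printing Implicit Defensive.

Import Order.TTheory GRing.Theory Num.Theory.

Local Open Scope classical_set_scope.
Local Open Scope ring_scope.

Variant scalar_kind := RealScalars | ComplexScalars.

Definition scalars (R : realType) (k : scalar_kind) : numFieldType :=
  match k with
  | RealScalars => R : numFieldType
  | ComplexScalars => R[i] : numFieldType
  end.

(* The library norm of R[i] takes its values in R[i]; this one is R-valued. *)
Definition modulus (R : realType) (k : scalar_kind) : scalars R k -> R :=
  match k return scalars R k -> R with
  | RealScalars => fun a : R => `|a|
  | ComplexScalars => fun a : R[i] => Normc.normc a
  end.

(* The library equips [prod_topology X] with the product topology; the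
   pointwise module structure on a dependent product is added here. *)
Section prod_topology_lmodule.
Variables (K : numDomainType) (I : Type) (X : I -> preTopologicalLmodType K).
Implicit Types f g h : prod_topology X.

Let add f g : prod_topology X := fun i => f i + g i.
Let opp f : prod_topology X := fun i => - f i.
Let zero : prod_topology X := fun i => 0.
Let scale (a : K) f : prod_topology X := fun i => a *: f i.

Let addA : associative add.
Proof. by move=> f g h; apply: functional_extensionality_dep => i; exact: addrA. Qed.

Let addC : commutative add.
Proof. by move=> f g; apply: functional_extensionality_dep => i; exact: addrC. Qed.

Let add0 : left_id zero add.
Proof. by move=> f; apply: functional_extensionality_dep => i; exact: add0r. Qed.

Let addN : left_inverse zero opp add.
Proof. by move=> f; apply: functional_extensionality_dep => i; exact: addNr. Qed.

HB.instance Definition _ :=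
  GRing.isZmodule.Build (prod_topology X) addA addC add0 addN.

Let scaleA a b f : scale a (scale b f) = scale (a * b) f.
Proof. by apply: functional_extensionality_dep => i; exact: scalerA. Qed.

Let scale1 : left_id 1 scale.
Proof. by move=> f; apply: functional_extensionality_dep => i; exact: scale1r. Qed.

Let scaleDr : right_distributive scale +%R.
Proof. by move=> a f g; apply: functional_extensionality_dep => i; exact: scalerDr. Qed.

Let scaleDl f : {morph scale^~ f : a b / a + b}.
Proof. by move=> a b; apply: functional_extensionality_dep => i; exact: scalerDl. Qed.

HB.instance Definition _ := GRing.Zmodule_isLmodule.Build K (prod_topology X)
  scaleA scale1 scaleDr scaleDl.

End prod_topology_lmodule.

Section extended_locally_convex_spaces.
Variables (R : realType) (k : scalar_kind).
Variable X : preTopologicalLmodType (scalars R k).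
Implicit Types (A : set X) (P : set (X -> \bar R)).

(* In the library, 0 * +oo = 0 in \bar R. *)
Definition extended_seminorm (rho : X -> \bar R) : Prop :=
  [/\ forall x, (0 <= rho x)%E,
      forall a x, rho (a *: x) = ((modulus a)%:E * rho x)%E &
      forall x y, (rho (x + y)%R <= rho x + rho y)%E].

Definition seminorm_balls P : set (set X) :=
  [set U | exists rho (x : X) (e : R),
    [/\ P rho, 0 < e & U = [set y | (rho (y - x)%R < e%:E)%E]]].

(* The finite intersections (including the empty one, setT) of the balls form
   a base, i.e. the balls form a subbase of the topology of X. *)
Definition topology_induced_by P : Prop :=
  basis (finI_from (seminorm_balls P) id).

Definition elcs : Prop :=
  hausdorff_space X /\
  exists P, (forall rho, P rho -> extended_seminorm rho) /\
            topology_induced_by P.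

Definition balanced A : Prop :=
  forall a x, modulus a <= 1 -> A x -> A (a *: x).

(* [convex_set] quantifies over t : scalars R k with 0 <= t <= 1; in the order
   of R[i] this forces t to be real. *)
Definition absolutely_convex A : Prop := balanced A /\ convex_set A.

Definition absorbing A : Prop :=
  forall x, exists2 r : R, 0 < r & forall a, modulus a <= r -> A (a *: x).

Definition barrel A : Prop :=
  [/\ closed A, absolutely_convex A & absorbing A].

Definition barreled : Prop := forall A, barrel A -> nbhs (0 : X) A.

End extended_locally_convex_spaces.
Arguments elcs {R k} X.
Arguments barreled {R k} X.

(* Main.v *)
(* The seminorms of the factors composed with the projections induce the product
   topology.  For barreledness, a gliding hump shows that a barrel B of the
   product contains every x vanishing on some finite set of indices: otherwise
   one builds s_n and increasing finite index sets G_n such that s_(n+1) agrees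
   with s_n on G_n and no y agreeing with s_(n+1) on G_(n+1) satisfies
   y/(n+1) \in B (B is closed); a y agreeing with every s_n on G_n is not
   absorbed by B.  Nothing here uses the continuity of a |-> a x, which may
   fail in extended spaces.  The finitely many remaining coordinates are handled
   by the barreledness of the factors and convexity. *)

Require Import Defs.
From mathcomp Require Import all_boot all_order all_algebra finmap complex.
From mathcomp Require Import all_classical all_reals all_analysis.

Set Implicit Arguments.
Unset Strict Implicit.
Unset Printing Implicit Defensive.

Import Order.TTheory GRing.Theory Num.Theory.

Local Open Scope classical_set_scope.
Local Open Scope ring_scope.

(** * Subbases and convergence of filters *)

Section subbase.
Variable T : topologicalType.
Implicit Types S : set (set T).

Lemma subbasis_cvg S (F : set_system T) (x : T) : Filter F ->
  basis (finI_from S id) -> (forall U, S U -> U x -> F U) -> F --> x.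
Proof.
move=> FF [_ Sx] SF A /Sx [_ [[D DS <-] Dx] DA].
apply: filterS DA _; apply: filter_bigI => U UD.
by apply: SF; [exact/set_mem/DS | exact: Dx].
Qed.

(** The criterion is applied to the filter generated by the finite intersections that contain [x];
    its convergence to [x] is the base property. *)
Lemma subbasisP S : S `<=` open ->
  (forall x (F : set_system T), Filter F ->
    (forall U, S U -> U x -> F U) -> F --> x) ->
  basis (finI_from S id).
Proof.
move=> So Scvg; split=> [_ [D DS <-]|x].
  rewrite openE => x Dx; apply: filter_bigI => U UD.
  apply: open_nbhs_nbhs; split; first exact/So/set_mem/DS.
  exact: Dx.
apply: Scvg => [|U SU Ux]; last first.
  by exists U => //; split=> //; exact: finI_from1.
apply: filter_from_filter => [|U V [SU Ux] [SV Vx]].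
  by exists setT; split=> //; exists fset0%fset => //;
    rewrite set_fset0 bigcap_set0.
by exists (U `&` V) => //; split; [exact: finI_fromI|].
Qed.

End subbase.

(** * Convergence and neighborhoods in a product *)

Section product.
Variables (I : eqType) (T : I -> topologicalType).

Lemma cvg_prod_topology (F : set_system (prod_topology T))
    (f : prod_topology T) :
  Filter F -> (forall i, @^~ i @ F --> f i) -> F --> f.
Proof.
move=> FF Ff; apply/cvg_sup => i A /=.
move=> [_ [[V oV <-] Vf VA]].
apply: filterS VA _; apply: Ff.
exact: open_nbhs_nbhs.
Qed.

Lemma prod_topology_eval_continuous i :
  continuous (fun f : prod_topology T => f i).
Proof. exact: proj_continuous. Qed.

(** The sets of functions agreeing with [f] on a finite list generate a filter. It converges to [f],
    since each coordinate is constant on one of these sets. *)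
Lemma nbhs_prod_topology (f : prod_topology T) U : nbhs f U ->
  exists J : seq I, forall g, {in J, forall i, g i = f i} -> U g.
Proof.
pose B (J : seq I) : set (prod_topology T) :=
  [set g | {in J, forall i, g i = f i}].
suff: filter_from setT B --> f by move=> /[apply] -[J _ JU]; exists J.
have FB : Filter (filter_from setT B).
  apply: filter_fromT_filter; first by exists [::].
  move=> J J'; exists (J ++ J') => g gJ.
  by split=> i iJ; apply: gJ; rewrite mem_cat iJ ?orbT.
apply: cvg_prod_topology => i A /nbhs_singleton Af.
by exists [:: i] => // g /= ->; rewrite ?inE.
Qed.

End product.

(** * The modulus of scalars *)

Section scalars.
Variables (R : realType) (k : scalar_kind).

Lemma modulus_gt0 (c : scalars R k) : c != 0 -> 0 < modulus c.
Proof.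
case: k c => c c0 /=; first by rewrite normr_gt0.
by rewrite -ltcR -[ltRHS]/(`|c|) normr_gt0.
Qed.

Lemma modulusN1 : modulus (-1 : scalars R k) = 1.
Proof.
by case: k => /=; [exact: normrN1 | exact: etrans (normcN _) (Normc.normc1 R)].
Qed.

Lemma modulus_natV n : modulus (n%:R^-1 : scalars R k) = n%:R^-1.
Proof.
case: k => /=; first by rewrite ger0_norm// invr_ge0.
rewrite Normc.normcV; congr _^-1.
exact: etrans (normcMn _ n) (congr1 (fun x => x *+ n) (Normc.normc1 R)).
Qed.

End scalars.

(** * Absolutely convex sets and scaling *)

Section elcs.
Variables (R : realType) (k : scalar_kind).
Variable X : preTopologicalLmodType (scalars R k).
Implicit Types (A : set X).

Lemma absolutely_convexN A x : absolutely_convex A -> A x -> A (- x).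
Proof.
by move=> [bA _] Ax; rewrite -scaleN1r; apply: bA => //; rewrite modulusN1.
Qed.

Lemma absolutely_convex_mid A x y : absolutely_convex A ->
  A x -> A y -> A (2^-1 *: (x + y)).
Proof.
move=> [_ cA] Ax Ay.
have h0 : 0 <= 2^-1 :> scalars R k by rewrite invr_ge0.
have h1 : 2^-1 <= 1 :> scalars R k by rewrite invf_le1 ?ler1n.
have := cA x y (Itv01 h0 h1) (mem_set Ax) (mem_set Ay).
move=> /set_mem; rewrite scalerDr; congr (A (_ + _ *: _)).
by rewrite -[LHS]/(1 - 2^-1) {1}(splitr 1) mul1r addrK.
Qed.

(** Multiplication by [c] pulls the ball of radius [e] about [z] back to the ball of radius
    [e / modulus c] about [c^-1 *: z], also where the seminorm is infinite. *)
Lemma elcs_scale_continuous (c : scalars R k) : elcs X -> c != 0 ->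
  continuous (fun x : X => c *: x).
Proof.
move=> [_ [P [sP bP]]] c0 x; apply: (subbasis_cvg _ bP) => U SU Ux.
apply: open_nbhs_nbhs; split => //.
move: SU {Ux} => [rho [z [e [Prho e0 ->]]]].
apply: bP.1.
apply: finI_from1; exists rho, (c^-1 *: z), (e / modulus c).
have m0 := modulus_gt0 c0.
split=> //; first exact: divr_gt0.
apply/funext => y /=; have [_ rZ _] := sP _ Prho.
rewrite -[in LHS](scalerKV c0 z) -scalerBr rZ.
by rewrite EFinM lte_pdivlMr// muleC.
Qed.

End elcs.

(** * Coordinate injections and restrictions *)

Section product_module.
Variables (K : numDomainType) (I : eqType) (X : I -> preTopologicalLmodType K).

Definition prod_inj i (u : X i) : prod_topology X :=
  dfwith (0 : prod_topology X) i u.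

Lemma prod_injD i : {morph prod_inj (i := i) : u v / u + v}.
Proof.
move=> u v; apply: functional_extensionality_dep => j.
rewrite -[RHS]/(prod_inj u j + prod_inj v j) /prod_inj.
have [<-|ij] := eqVneq i j; first by rewrite !dfwithin.
by rewrite !dfwithout// addr0.
Qed.

Lemma prod_injZ i a (u : X i) : prod_inj (a *: u) = a *: prod_inj u.
Proof.
apply: functional_extensionality_dep => j.
rewrite -[RHS]/(a *: prod_inj u j) /prod_inj.
have [<-|ij] := eqVneq i j; first by rewrite !dfwithin.
by rewrite !dfwithout// scaler0.
Qed.

Definition prod_restrict (J : seq I) (x : prod_topology X) : prod_topology X :=
  fun i => if i \in J then x i else 0.

End product_module.

(** * Barrels in the product *)

Section barrel_in_product.
Variables (R : realType) (k : scalar_kind) (I : eqType).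
Variable X : I -> preTopologicalLmodType (scalars R k).
Variable B : set (prod_topology X).
Hypothesis barB : barrel B.

(* With x as in the hypothesis for J = G, the barrel cannot contain both
   s/(n+1) + x and s/(n+1) - x, as x is the midpoint of the first and of
   the opposite of the second. *)
Lemma barrel_avoid (s : prod_topology X) (G : seq I) (n : nat) :
  (forall J : seq I, exists2 x : prod_topology X,
    {in J, forall i, x i = 0} & ~ B x) ->
  exists t : prod_topology X * seq I,
    [/\ {subset G <= t.2}, {in G, forall i, t.1 i = s i} &
        forall y : prod_topology X, {in t.2, forall i, y i = t.1 i} ->
          ~ B (n.+1%:R^-1 *: y)].
Proof.
move=> /(_ G) [x x0 Bx]; have [clB acB _] := barB.
have n0 : n.+1%:R != 0 :> scalars R k by rewrite pnatr_eq0.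
have [z zG Bz] : exists2 z : prod_topology X, {in G, forall i, z i = s i} &
    ~ B (n.+1%:R^-1 *: z).
  have [Bp|] := pselect (B (n.+1%:R^-1 *: (s + n.+1%:R *: x))); last first.
    exists (s + n.+1%:R *: x) => // i iG.
    by rewrite -[LHS]/(s i + _ *: x i) x0// scaler0 addr0.
  exists (s - n.+1%:R *: x) => [i iG|Bm].
    by rewrite -[LHS]/(s i - _ *: x i) x0// scaler0 subr0.
  apply: Bx; have := absolutely_convex_mid acB Bp (absolutely_convexN acB Bm).
  rewrite -scalerN -scalerDr opprB addrC addrA subrK -scalerDr scalerK//.
  by rewrite -mulr2n -[x *+ 2]scaler_nat scalerK// pnatr_eq0.
(* As [B] is closed, agreement on some finite [J] with this point outside [B] already keeps a point
   outside [B]. *)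
have /nbhs_prod_topology [J JB] : nbhs (n.+1%:R^-1 *: z) (~` B).
  by apply: open_nbhs_nbhs; split=> //; exact: closed_openC.
exists (z, G ++ J); split=> [i iG|//|y yz] /=; first by rewrite mem_cat iG.
apply: JB => i iJ; rewrite -[LHS]/(_ *: y i) -[RHS]/(_ *: z i) yz//.
by rewrite mem_cat iJ orbT.
Qed.

Lemma barrel_cofinite : exists J : seq I, forall x : prod_topology X,
  {in J, forall i, x i = 0} -> B x.
Proof.
apply: contrapT => noJ.
have H (J : seq I) : exists2 x : prod_topology X,
    {in J, forall i, x i = 0} & ~ B x.
  apply: contrapT => /forall2NP JB; apply: noJ; exists J => x x0.
  by have [//|/contrapT] := JB x.
have [next nextP] := choice (fun p : (prod_topology X * seq I) * nat =>
  barrel_avoid p.1.1 p.1.2 p.2 H).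
(* [p n] is the pair of the hump [s_n] and its index set [G_n]. *)
pose p n := iteri n (fun m q => next (q, m)) (0, [::]).
have pS n : p n.+1 = next (p n, n) by [].
have pmon m n : (m <= n)%N -> {subset (p m).2 <= (p n).2} /\
    {in (p m).2, forall i, (p n).1 i = (p m).1 i}.
  elim: n => [|n IHn]; first by rewrite leqn0 => /eqP ->.
  rewrite leq_eqVlt => /predU1P[->|]; first by split.
  rewrite ltnS => /IHn [sub eqi].
  have [sub' eqi' _] := nextP (p n, n); rewrite pS.
  by split=> i im; [exact/sub'/sub | rewrite eqi' ?eqi//; exact: sub].
(* All stages whose index set contains [i] have the same value there; a coordinate that is never
   reached gets 0. *)
have ylim i : exists v : X i, forall n, i \in (p n).2 -> v = (p n).1 i.
  have [[m im]|no] := pselect (exists m, i \in (p m).2); last first.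
    by exists 0 => n iN; case: no; exists n.
  exists ((p m).1 i) => n iN.
  by have [/pmon [_ /(_ _ im)]|/ltnW/pmon [_ /(_ _ iN)]] := leqP m n.
pose y : prod_topology X := fun i => sval (cid (ylim i)).
have yE n i : i \in (p n).2 -> y i = (p n).1 i.
  by rewrite /y; case: cid => v /= /[apply].
have [_ _ /(_ y)[r r0 rB]] := barB.
have [n nr] : exists n : nat, r^-1 <= n.+1%:R.
  exists (Num.bound r^-1); rewrite ltW// (lt_trans (archi_boundP _))//.
    by rewrite invr_ge0 ltW.
  by rewrite ltr_nat.
(* Stage [n.+1] excludes [n.+1%:R^-1 *: y] from [B], while absorption puts it there because
   [n.+1%:R^-1 <= r]. *)
have [_ _ /(_ y)] := nextP (p n, n); apply; first by move=> i; exact: (yE n.+1).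
apply: rB; rewrite modulus_natV -[leRHS]invrK lef_pV2// posrE ?invr_gt0//.
Qed.

Lemma barrel0 : B 0.
Proof.
have [_ _ /(_ 0)[r r0 rB]] := barB; rewrite -(scaler0 _ 0); apply: rB.
(* Since the inverse of 0 is 0, the modulus of 0 is the case of the natural number 0. *)
by rewrite -(invr0 (scalars R k)) (modulus_natV R k 0) invr0 ltW.
Qed.

(** This brings the barrel to a factor, where barreledness applies; the injection is continuous and
    linear. *)
Lemma barrel_prod_inj i : barrel (@prod_inj _ _ X i @^-1` B).
Proof.
have [clB [bB cB] aB] := barB; split.
- by apply: preimage_closed clB => ? _; exact: dfwith_continuous.
- split=> [a u a1 /= /(bB a _ a1)|u v l /set_mem/= Bu /set_mem/= Bv].
    by rewrite prod_injZ.
  apply/mem_set => /=; rewrite prod_injD !prod_injZ.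
  exact: set_mem (cB _ _ l (mem_set Bu) (mem_set Bv)).
- move=> u; have [r r0 rB] := aB (prod_inj u).
  by exists r => // a /rB /=; rewrite prod_injZ.
Qed.

Hypothesis hX : forall i, elcs (X i) /\ barreled (X i).

(** Induction on [J], with [c] general because every new index doubles it: the vector is the
    midpoint of its part on [J] and its part at [j], both scaled by [2 * c]. *)
Lemma barrel_restrict_near (J : seq I) (c : scalars R k) : c != 0 ->
  \forall x \near (0 : prod_topology X), B (c *: prod_restrict J x).
Proof.
have [_ acB _] := barB.
have n2 : 2 != 0 :> scalars R k by rewrite pnatr_eq0.
elim: J c => [|j J IHJ] c c0.
  apply: (@nearW _ (nbhs (0 : prod_topology X))) => x.
  suff -> : prod_restrict [::] x = 0.
    by rewrite scaler0; exact: barrel0.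
  exact: functional_extensionality_dep.
(* A repeated index does not change the restriction; the splitting below would count it twice. *)
have [jJ|jJ] := boolP (j \in J).
  apply: filterS (IHJ c c0) => x; congr (B (_ *: _)).
  apply: functional_extensionality_dep => i.
  by rewrite /prod_restrict inE; case: eqVneq => // ->; rewrite jJ.
have c20 : 2 * c != 0 by rewrite mulf_neq0.
have cj : (fun x : prod_topology X => (2 * c) *: x j) @ 0 -->
    (2 * c) *: (0 : X j).
  apply: cvg_comp; first exact: prod_topology_eval_continuous.
  exact: elcs_scale_continuous (hX j).1 c20 _.
rewrite scaler0 in cj.
have := cj _ ((hX j).2 _ (barrel_prod_inj j)).
apply: filterS2 (IHJ _ c20) => x BJ /= Bj.
suff -> : c *: prod_restrict (j :: J) x =
    2^-1 *: ((2 * c) *: prod_restrict J x + prod_inj ((2 * c) *: x j)).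
  exact: absolutely_convex_mid.
rewrite prod_injZ -scalerDr scalerA mulKf//; congr (_ *: _).
apply: functional_extensionality_dep => i.
rewrite -[RHS]/(prod_restrict J x i + prod_inj (x j) i).
rewrite /prod_restrict /prod_inj inE.
have [->|ij] := eqVneq i j; first by rewrite dfwithin (negbTE jJ) add0r.
by rewrite dfwithout 1?eq_sym// addr0.
Qed.

Lemma barrel_prod_nbhs : nbhs (0 : prod_topology X) B.
Proof.
have n2 : 2 != 0 :> scalars R k by rewrite pnatr_eq0.
have [J JB] := barrel_cofinite; have [_ acB _] := barB.
apply: filterS (barrel_restrict_near J n2) => x Bx.
(* The second vector vanishes on [J], so it lies in [B] by the choice of [J]. *)
have -> : x = 2^-1 *: (2 *: prod_restrict J x + 2 *: (x - prod_restrict J x)).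
  by rewrite -scalerDr addrCA subrr addr0 scalerK.
apply: absolutely_convex_mid => //; apply: JB => i iJ.
rewrite -[LHS]/(2 *: (x i - prod_restrict J x i)) /prod_restrict iJ.
by rewrite subrr scaler0.
Qed.

End barrel_in_product.

(** * Seminorms on the product and the conclusion *)

Section product_elcs.
Variables (R : realType) (k : scalar_kind) (I : eqType).
Variable X : I -> preTopologicalLmodType (scalars R k).

Lemma elcs_prod_topology : (forall i, elcs (X i)) -> elcs (prod_topology X).
Proof.
move=> hX; split; first by apply: hausdorff_product => i; case: (hX i).
pose P i := sval (cid (hX i).2).
have sP i rho : P i rho -> extended_seminorm rho.
  exact: (svalP (cid (hX i).2)).1.
have bP i : topology_induced_by (P i) := (svalP (cid (hX i).2)).2.
exists [set rho | exists i, exists2 q, P i q & rho = fun x => q (x i)]; split.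
  move=> _ [i [q /sP [q0 qZ qD] ->]]; split=> [x|a x|x y].
  - exact: q0.
  - exact: qZ.
  - exact: qD.
apply: subbasisP => [_ [_ [x [e [[i [q Pq ->]] e0 ->]]]]|x F FF Fball].
  pose V := [set u : X i | (q (u - x i)%R < e%:E)%E].
  have oV : open V.
    by apply: (bP i).1; apply: finI_from1; exists q, (x i), e.
  by apply: open_comp oV => f _; exact: prod_topology_eval_continuous.
apply: cvg_prod_topology => i.
apply: (subbasis_cvg _ (bP i)) => _ [q [u [e [Pq e0 ->]]]] xu.
apply: (Fball [set f | (q (f i - u)%R < e%:E)%E]) => //.
(* A ball of the product needs a center there; only its coordinate [i], equal to [u], matters. *)
exists (fun x => q (x i)), (prod_inj u), e; split=> //.
  by exists i, q.
apply/funext => f /=.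
by rewrite -[((f - _) i)]/(f i - prod_inj u i) /prod_inj dfwithin.
Qed.

End product_elcs.

Theorem theorem3p23 (R : realType) (k : scalar_kind) (I : Type)
    (X : I -> preTopologicalLmodType (scalars R k))
    (hX : forall i, elcs (X i) /\ barreled (X i)) :
  elcs (prod_topology X) /\ barreled (prod_topology X).
Proof.
split.
  (* [{classic I}] gives [I] the decidable equality used for lists of indices and for [dfwith]. *)
  by apply: (@elcs_prod_topology R k {classic I} X) => i; case: (hX i).
by move=> B barB; exact: (@barrel_prod_nbhs R k {classic I} X B barB hX).
Qed.
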